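(* Let $\phi\in L^p(\partial\Omega)$. Let $(\widetilde\eta^{(n)})_{n\ge0}$ be the sequence in $L^\infty(\omega)$ given by $\widetilde\eta^{(0)}\equiv0$, $\widetilde\eta^{(1)}=\mathcal{K}_1\phi$ and $$\widetilde\eta^{(n+1)}=\widetilde\eta^{(n)}-\mathcal{K}_1K_2\left(\left(\widetilde\eta^{(n)}-\widetilde\eta^{(n-1)}\right)\otimes\widetilde\eta^{(1)}\right),\qquad n\ge1,$$ and let $\widetilde\eta_j=\widetilde{\mathcal{K}}_j\phi^{\otimes j}$, $j\ge1$, be the terms of the reduced inverse Born series. Then $$\widetilde\eta^{(n)}\simeq\sum_{j=1}^n\widetilde\eta_j,\qquad n\ge1.$$
   Context: Let $\Omega\subset\mathbb{R}^d$ ($d\ge2$) be a bounded domain, and $\omega\subset\Omega$ a closed subset with a finite (positive) distance separating $\partial\omega$ and $\partial\Omega$. Functions in $L^\infty(\omega)$ are regarded as functions on $\Omega$ supported in $\omega$. Let $D_0,\alpha_0,\beta>0$ be constants, $f$ a source term, and $\partial_\nu$ the outer normal derivative on $\partial\Omega$. Let $u_0$ solve $-D_0\Delta u_0+\alpha_0u_0=f$ in $\Omega$, $D_0\partial_\nu u_0+\beta u_0=0$ on $\partial\Omega$, and let $G(x,y)$ be the corresponding Green's function: $-D_0\Delta_x G(x,y)+\alpha_0G(x,y)=\delta(x-y)$ for $x\in\Omega$, with $D_0\partial_\nu G+\beta G=0$ for $x\in\partial\Omega$, $y\in\Omega$. Fix $1\le p\le\infty$. $K_1:L^\infty(\omega)\to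 L^p(\partial\Omega)$ is the bounded linear operator $(K_1\xi)(x)=\alpha_0\int_\Omega G(x,y)\xi(y)u_0(y)\,dy$, and $K_2$ is the bounded bilinear operator $K_2(\xi_1\otimes\xi_2)(x)=-\alpha_0^2\int_\Omega\int_\Omega G(x,y_1)\xi_1(y_1)G(y_1,y_2)\xi_2(y_2)u_0(y_2)\,dy_1dy_2$, $x\in\partial\Omega$, from $L^\infty(\omega)\times L^\infty(\omega)$ to $L^p(\partial\Omega)$. $\mathcal{K}_1:L^p(\partial\Omega)\to L^\infty(\omega)$ is a regularized pseudoinverse of $K_1$, a bounded linear operator approximating the Moore-Penrose pseudoinverse of $K_1$. Tensor notation: an operator applied to $\xi_1\otimes\cdots\otimes\xi_n$ denotes a multilinear map in $(\xi_1,\dots,\xi_n)$, and $(A_1\otimes\cdots\otimes A_m)$ acts blockwise: if $A_k$ takes $i_k$ arguments, $A_1$ is applied to the first $i_1$ arguments, $A_2$ to the next $i_2$, and so on, the $m$ results being the tensor factors of the output. $A^{\otimes n}=A\otimes\cdots\otimes A$ ($n$ factors). The operators $\widetilde{\mathcal{K}}_j$ ($j$-linear from $L^p(\partial\Omega)$ to $L^\infty(\omega)$) are defined by $\widetilde{\mathcal{K}}_1=\mathcal{K}_1$, $\widetilde{\mathcal{K}}_2=-\mathcal{K}_1K_2(\mathcal{K}_1\otimes\mathcal{K}_1)$, and $\widetilde{\mathcal{K}}_j=-\left(\widetilde{\mathcal{K}}_{j-1}K_2\otimes K_1^{\otimes(j-2)}\right)\mathcal{K}_1^{\otimes j}$ for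 $j\ge3$, i.e. $\widetilde{\mathcal{K}}_j(\phi_1\otimes\cdots\otimes\phi_j)=-\widetilde{\mathcal{K}}_{j-1}\left(K_2(\mathcal{K}_1\phi_1\otimes\mathcal{K}_1\phi_2)\otimes K_1\mathcal{K}_1\phi_3\otimes\cdots\otimes K_1\mathcal{K}_1\phi_j\right)$. It is assumed that $\mathcal{K}_1K_1:L^\infty(\omega)\to L^\infty(\omega)$ is close to the identity $I$: $\mathcal{K}_1K_1=I+\epsilon V$, where $\epsilon>0$ is small and $V$ is an operator with $\|V\|=1$, so that $\|\mathcal{K}_1K_1-I\|=\epsilon$. For two operators $\mathcal{A},\mathcal{B}:L^\infty(\omega)\to L^\infty(\omega)$, one writes $\mathcal{A}\simeq\mathcal{B}$ if $\|\mathcal{A}-\mathcal{B}\|=O(\epsilon)$; similarly, one writes $\mathcal{A}\eta\simeq\mathcal{B}\eta$ ($\eta\in L^\infty(\omega)$) if $\mathcal{A}\simeq\mathcal{B}$. The same notation is used for multilinear operators and for the elements of $L^\infty(\omega)$ obtained by applying them, as in the claim. *)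

(* Defs.v *)
From HB Require Import structures.
From mathcomp Require Import all_boot all_order all_algebra.
From mathcomp Require Import sesquilinear generic_quotient interval_inference.
From mathcomp Require Import boolp classical_sets functions cardinality reals.
From mathcomp Require Import ereal topology normedtype sequences derive measure.
From mathcomp Require Import lebesgue_measure measurable_realfun ess_sup_inf.
From mathcomp Require Import lebesgue_integral exp numfun hoelder.

Set Implicit Arguments.
Unset Strict Implicit.
Unset Printing Implicit Defensive.
Import Order.TTheory GRing.Theory Num.Theory.
Import numFieldNormedType.Exports.

Local Open Scope classical_set_scope.
Local Open Scope ring_scope.

(* LspaceType (hoelder.v) carries no vector space structure and LfunType is
   only seminormed by 'N[mu]_p, so L^p is built here as the normed space
   quotient of LfunType by almost everywhere equality; p = +oo is allowed. *)
Section Lp_space.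
Context {d} {T : measurableType d} {R : realType}.
Variables (mu : {measure set T -> \bar R}) (p : \bar R) (p1 : (1 <= p)%E).

Local Notation Lf := (LfunType mu p1).

Definition Lp_eq (f g : Lf) : bool := `[<(f : T -> R) = g %[ae mu] >].

Lemma Lp_eq_refl : reflexive Lp_eq.
Proof. by move=> f; apply/asboolP; exact: aeW. Qed.
Lemma Lp_eq_sym : symmetric Lp_eq.
Proof. by move=> f g; apply/asboolP/asboolP => /ae_eq_sym. Qed.
Lemma Lp_eq_trans : transitive Lp_eq.
Proof.
by move=> g f h /asboolP fg /asboolP gh; apply/asboolP; exact: ae_eq_trans fg gh.
Qed.
Canonical Lp_equiv := EquivRel Lp_eq Lp_eq_refl Lp_eq_sym Lp_eq_trans.

Definition Lp : Type := {eq_quot Lp_eq}%qT.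
HB.instance Definition _ := Choice.on Lp.
HB.instance Definition _ := EqQuotient.on Lp.

Implicit Types u v w : Lp.
Definition Lp_repr u : Lf := repr u.
Definition Lp_fun u : T -> R := Lp_repr u.

Local Notation cls f := (\pi_(Lp)%qT (f : Lf)).

Lemma clsK u : cls (Lp_repr u) = u. Proof. exact: reprK. Qed.
Lemma reprcls (f : Lf) : (Lp_repr (cls f) : T -> R) = f %[ae mu].
Proof. by have /eqmodP/asboolP := reprK (cls f). Qed.
Lemma cls_eq (f g : Lf) : (f : T -> R) = g %[ae mu] -> cls f = cls g.
Proof. by move=> fg; apply/eqmodP/asboolP. Qed.

Definition Lp_zero : Lp := cls 0.
Definition Lp_add u v : Lp := cls (Lp_repr u + Lp_repr v).
Definition Lp_opp u : Lp := cls (- Lp_repr u).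
Definition Lp_scale (a : R) u : Lp := cls (a *: Lp_repr u).

Lemma cls_add (f g : Lf) : Lp_add (cls f) (cls g) = cls (f + g).
Proof.
apply: cls_eq; apply: filterS2 (reprcls f) (reprcls g) => x fx gx _.
by congr (_ + _); [exact: fx|exact: gx].
Qed.
Lemma cls_opp (f : Lf) : Lp_opp (cls f) = cls (- f).
Proof.
apply: cls_eq; apply: filterS (reprcls f) => x fx _.
by congr (- _); exact: fx.
Qed.
Lemma cls_scale a (f : Lf) : Lp_scale a (cls f) = cls (a *: f).
Proof.
apply: cls_eq; apply: filterS (reprcls f) => x fx _.
by congr (_ * _); exact: fx.
Qed.

Lemma Lp_addA : associative Lp_add.
Proof. by move=> u v w; rewrite -(clsK u) -(clsK v) -(clsK w) !cls_add addrA. Qed.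
Lemma Lp_addC : commutative Lp_add.
Proof. by move=> u v; rewrite -(clsK u) -(clsK v) !cls_add addrC. Qed.
Lemma Lp_add0 : left_id Lp_zero Lp_add.
Proof. by move=> u; rewrite -(clsK u) cls_add add0r. Qed.
Lemma Lp_addN : left_inverse Lp_zero Lp_opp Lp_add.
Proof. by move=> u; rewrite -(clsK u) cls_opp cls_add addNr. Qed.
HB.instance Definition _ :=
  GRing.isZmodule.Build Lp Lp_addA Lp_addC Lp_add0 Lp_addN.

Lemma Lp_scaleA a b u : Lp_scale a (Lp_scale b u) = Lp_scale (a * b) u.
Proof. by rewrite -(clsK u) !cls_scale scalerA. Qed.
Lemma Lp_scale1 : left_id 1 Lp_scale.
Proof. by move=> u; rewrite -(clsK u) cls_scale scale1r. Qed.
Lemma Lp_scaleDr : right_distributive Lp_scale +%R.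
Proof.
by move=> a u v; rewrite -(clsK u) -(clsK v) [_ + _]cls_add !cls_scale scalerDr [RHS]cls_add.
Qed.
Lemma Lp_scaleDl u : {morph Lp_scale^~ u : a b / a + b}.
Proof. by move=> a b; rewrite -(clsK u) !cls_scale scalerDl [RHS]cls_add. Qed.
HB.instance Definition _ :=
  GRing.Zmodule_isLmodule.Build R Lp Lp_scaleA Lp_scale1 Lp_scaleDr Lp_scaleDl.

Definition Lp_norm u : R := fine 'N[mu]_p[EFin \o Lp_fun u]%E.

Lemma Lnorm_ae (f g : Lf) : (f : T -> R) = g %[ae mu] ->
  'N[mu]_p[EFin \o f]%E = 'N[mu]_p[EFin \o g]%E.
Proof.
move=> fg; rewrite unlock /Lnorm.
case: p p1 f g fg => [r||] r1 f g fg; last by [].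
- have mp (h : LfunType mu r1) :
      measurable_fun [set: T] (fun x => `|(EFin \o h) x| `^ r)%E.
    rewrite /comp /=; apply/measurable_EFinP.
    apply: (@measurableT_comp _ _ _ _ _ _ (@powR R ^~ r)) => //.
    exact: measurableT_comp.
  congr (_ `^ _)%E; apply: ae_eq_integral => //.
  by apply: filterS fg => x + _ => /(_ I) /= ->.
- case: ifP => // _; apply: eq_ess_sup.
  by apply: filterS fg => x /(_ I) /= ->.
Qed.

Lemma Lp_normE (f : Lf) : Lp_norm (cls f) = fine 'N[mu]_p[EFin \o f]%E.
Proof. by rewrite /Lp_norm (Lnorm_ae (reprcls f)). Qed.
Lemma Lp_normD u v : Lp_norm (u + v) <= Lp_norm u + Lp_norm v.
Proof.
by rewrite -(clsK u) -(clsK v) [_ + _]cls_add !Lp_normE ler_LnormD.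
Qed.
Lemma Lp_normZ a u : Lp_norm (a *: u) = `|a| * Lp_norm u.
Proof.
rewrite -(clsK u) [_ *: _]cls_scale !Lp_normE.
by apply: EFin_inj; rewrite EFinM !finite_norm_fine -LnormZ.
Qed.
Lemma Lp_norm0_eq0 u : Lp_norm u = 0 -> u = 0.
Proof.
by rewrite -(clsK u) Lp_normE => /fine_Lnormr_eq0 u0; exact: cls_eq.
Qed.
HB.instance Definition _ :=
  Lmodule_isNormed.Build R Lp Lp_normD Lp_normZ Lp_norm0_eq0.

End Lp_space.

(* Every set is measurable in [discrete T]: mu_ext over [discrete T] takes the
   infimum of \sum_k g (F k) over all countable covers F. *)
Definition discrete (T : Type) : Type := T.
HB.instance Definition _ (T : pointedType) := Pointed.on (discrete T).
HB.instance Definition _ (T : pointedType) := @isMeasurable.Build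
  default_measure_display (discrete T) discrete_measurable
  discrete_measurable0 discrete_measurableC discrete_measurableU.

Section euclidean_measures.
Context {R : realType}.

(* The library norm on 'rV[R]_d is the sup norm; lengths, normals and diameters
   below are Euclidean. *)
Definition dot {d} (x y : 'rV[R]_d) : R := \sum_(i < d) x 0 i * y 0 i.
Definition enorm {d} (x : 'rV[R]_d) : R := Num.sqrt (dot x x).

(* Infimum of the volumes of the closed boxes containing C. *)
Definition box_gauge d (C : set (discrete 'rV[R]_d)) : \bar R :=
  if C == set0 then 0%E else
  ereal_inf [set (\prod_(i < d) (ab.2 0 i - ab.1 0 i))%:E |
    ab in [set ab : 'rV[R]_d * 'rV[R]_d |
      (forall i, ab.1 0 i <= ab.2 0 i) /\
      (forall x, C x -> forall i, ab.1 0 i <= x 0 i <= ab.2 0 i)]].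

Lemma box_gauge0 d : @box_gauge d set0 = 0%E.
Proof. by rewrite /box_gauge eqxx. Qed.

Lemma box_gauge_ge0 d (C : set (discrete 'rV[R]_d)) : (0 <= box_gauge C)%E.
Proof.
rewrite /box_gauge; case: ifP => // _.
apply: le_ereal_inf_tmp => _ [[a b] /= [ab _] <-].
by rewrite lee_fin prodr_ge0// => i _; rewrite subr_ge0.
Qed.

Definition lebesgue_outer d : set 'rV[R]_d -> \bar R := mu_ext (@box_gauge d).

HB.instance Definition _ d := isOuterMeasure.Build R _ (@lebesgue_outer d)
  (mu_ext0 (@box_gauge0 d) (@box_gauge_ge0 d)) (mu_ext_ge0 (@box_gauge_ge0 d))
  (le_mu_ext (@box_gauge d)) (mu_ext_sigma_subadditive (@box_gauge_ge0 d)).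

Definition diam {d} (C : set 'rV[R]_d) : \bar R :=
  ereal_sup [set (enorm (xy.1 - xy.2))%:E | xy in C `*` C].

Definition unit_ball d : set 'rV[R]_d := [set x | enorm x <= 1].

(* The factor |unit ball of R^s| / 2^s normalises the s-dimensional Hausdorff
   measure so that it is the usual area on smooth hypersurfaces (s = d - 1);
   the value +oo forbids covers by sets of diameter larger than delta. *)
Definition hausdorff_gauge d (s : nat) (delta : R) (C : set (discrete 'rV[R]_d)) : \bar R :=
  if C == set0 then 0%E else
  if (diam C <= delta%:E)%E then
    (lebesgue_outer (@unit_ball s) *
      (diam C * (2^-1)%:E) ^+ s)%E
  else +oo%E.

Lemma hausdorff_gauge0 d s delta : @hausdorff_gauge d s delta set0 = 0%E.
Proof. by rewrite /hausdorff_gauge eqxx. Qed.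

Lemma hausdorff_gauge_ge0 d s delta (C : set (discrete 'rV[R]_d)) :
  (0 <= hausdorff_gauge s delta C)%E.
Proof.
rewrite /hausdorff_gauge; case: ifPn => // /set0P[x Cx]; case: ifP => // _.
apply: mule_ge0; first exact: outer_measure_ge0.
apply: expe_ge0; apply: mule_ge0; last by rewrite lee_fin invr_ge0.
apply: le_ereal_sup_tmp; exists (enorm (x - x))%:E; first by exists (x, x).
by rewrite lee_fin sqrtr_ge0.
Qed.

Definition hausdorff_outer d (s : nat) (A : set 'rV[R]_d) : \bar R :=
  ereal_sup [set mu_ext (@hausdorff_gauge d s delta) A | delta in [set delta | 0 < delta]].

Lemma hausdorff_outer_lb d s delta A : 0 < delta ->
  (mu_ext (@hausdorff_gauge d s delta) A <= hausdorff_outer s A)%E.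
Proof. by move=> d0; apply: ereal_sup_ubound; exists delta. Qed.

Lemma hausdorff_outer_ge0 d s A : (0 <= @hausdorff_outer d s A)%E.
Proof.
apply: le_trans (hausdorff_outer_lb s A ltr01).
exact/mu_ext_ge0/hausdorff_gauge_ge0.
Qed.

Lemma hausdorff_outer0 d s : @hausdorff_outer d s set0 = 0%E.
Proof.
apply/eqP; rewrite eq_le hausdorff_outer_ge0 andbT.
apply: ge_ereal_sup => _ [delta _ <-].
by rewrite mu_ext0//; [exact: hausdorff_gauge0|exact: hausdorff_gauge_ge0].
Qed.

Lemma le_hausdorff_outer d s :
  {homo @hausdorff_outer d s : A B / A `<=` B >-> (A <= B)%E}.
Proof.
move=> A B AB; apply: ge_ereal_sup => _ [delta d0 <-].
by apply: le_trans (hausdorff_outer_lb s B d0); exact: le_mu_ext.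
Qed.

Lemma hausdorff_outer_sigma_subadditive d s :
  sigma_subadditive (@hausdorff_outer d s).
Proof.
move=> F; apply: ge_ereal_sup => _ [delta d0 <-].
apply: (le_trans (mu_ext_sigma_subadditive (@hausdorff_gauge_ge0 d s delta) _)).
apply: lee_nneseries => [i _ _|i _]; first exact/mu_ext_ge0/hausdorff_gauge_ge0.
exact: hausdorff_outer_lb.
Qed.

HB.instance Definition _ d s := isOuterMeasure.Build R _ (@hausdorff_outer d s)
  (@hausdorff_outer0 d s) (@hausdorff_outer_ge0 d s)
  (@le_hausdorff_outer d s) (@hausdorff_outer_sigma_subadditive d s).

(* Restricting the outer measure instead of the measure requires no
   measurability of D: if D is measurable, A is Caratheodory measurable for
   outer_restr mu D iff A `&` D is for mu, and ~` D is negligible. *)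
Section restriction.
Variables (T : Type) (mu : {outer_measure set T -> \bar R}) (D : set T).
Definition outer_restr (A : set T) : \bar R := mu (A `&` D).
Lemma outer_restr0 : outer_restr set0 = 0%E.
Proof. by rewrite /outer_restr set0I outer_measure0. Qed.
Lemma outer_restr_ge0 A : (0 <= outer_restr A)%E.
Proof. exact: outer_measure_ge0. Qed.
Lemma le_outer_restr : {homo outer_restr : A B / A `<=` B >-> (A <= B)%E}.
Proof. by move=> A B AB; apply: le_outer_measure; exact: setSI. Qed.
Lemma outer_restr_sigma_subadditive : sigma_subadditive outer_restr.
Proof.
by move=> F; rewrite /outer_restr setI_bigcupl; exact: outer_measure_sigma_subadditive.
Qed.
HB.instance Definition _ := isOuterMeasure.Build R T outer_restr
  outer_restr0 outer_restr_ge0 le_outer_restr outer_restr_sigma_subadditive.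
End restriction.

Definition boundary {T : topologicalType} (A : set T) := closure A `\` interior A.

Definition cara_measure (T : pointedType) (mu : {outer_measure set T -> \bar R}) :
  {measure set (caratheodory_type mu) -> \bar R} := mu.

Definition volume d := cara_measure (@lebesgue_outer d).
Definition volume_on d (D : set 'rV[R]_d) :=
  cara_measure (outer_restr (@lebesgue_outer d) D).
Definition surface d (D : set 'rV[R]_d) :=
  cara_measure (outer_restr (@hausdorff_outer d d.-1) (boundary D)).

End euclidean_measures.

Section robin.
Context {R : realType} {d : nat}.
Implicit Types (x y nu v : 'rV[R]_d) (u psi : 'rV[R]_d -> R).
Implicit Types (Omega S : set 'rV[R]_d).

Definition bounded_domain Omega :=
  [/\ open Omega, connected Omega, Omega !=set0 & bounded_set Omega].

Definition basis_vec (i : 'I_d) : 'rV[R]_d := delta_mx 0 i.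

Definition laplacian psi x : R :=
  \sum_(i < d) 'D_(basis_vec i) (fun y => 'D_(basis_vec i) psi y) x.

(* k times continuously differentiable on R^d. *)
Fixpoint Ck (k : nat) psi : Prop :=
  continuous psi /\
  match k with
  | 0%N => True
  | k'.+1 => forall i, (forall x, derivable psi x (basis_vec i)) /\
                       Ck k' (fun x => 'D_(basis_vec i) psi x)
  end.

Definition test_function Omega psi :=
  (forall k, Ck k psi) /\
  exists K, [/\ compact K, K `<=` Omega & forall x, ~ K x -> psi x = 0].

(* Near x, Omega agrees with the half-space {h | dot h nu < 0} up to thin cones.
   If the boundary is C^1 such a nu exists, and is unique, at each of its
   points. *)
Definition outer_normal Omega x nu :=
  enorm nu = 1 /\
  forall e, 0 < e -> exists2 r, 0 < r & forall h : 'rV[R]_d, enorm h < r ->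
    (dot h nu < - e * enorm h -> Omega (x + h)) /\
    (e * enorm h < dot h nu -> ~ Omega (x + h)).

Definition normal_derivative u x nu (l : R) :=
  (u x - u (x - t *: nu)) / t @[t --> 0^'+] --> l.

(* The equation - D0 * laplacian u + alpha0 * u = f holds in the sense of
   distributions on Omega and the boundary condition holds pointwise. The source
   f is given by its action on test functions: psi |-> \int_Omega f psi for a
   function, psi |-> psi y for the Dirac mass at y; since u is integrable the
   equation itself makes f a distribution. u may be singular on S, which is kept
   away from the boundary (a source point, or the support of a rough source).
   Continuity of u up to the boundary gives its boundary values and makes the
   one-sided limit in normal_derivative meaningful. *)
Definition robin_solution (D0 alpha0 beta : R) Omega S
    (f : ('rV[R]_d -> R) -> R) u :=
  [/\ (volume d).-integrable Omega (EFin \o u),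
      {within closure Omega `\` S, continuous u},
      (forall psi, test_function Omega psi ->
        \int[volume d]_(x in Omega)
          (u x * (- D0 * laplacian psi x + alpha0 * psi x)) = f psi) &
      (forall x nu, boundary Omega x -> outer_normal Omega x nu ->
        exists2 l, normal_derivative u x nu l & D0 * l + beta * u x = 0)].

Definition robin_green D0 alpha0 beta Omega (G : 'rV[R]_d -> 'rV[R]_d -> R) :=
  forall y, Omega y ->
    robin_solution D0 alpha0 beta Omega [set y] (fun psi => psi y) (G^~ y).

End robin.

Section born_operators.
Context {R : realType} {d : nat}.
Implicit Types (Omega omega : set 'rV[R]_d) (x : 'rV[R]_d).

Definition Linfty omega : normedModType R := Lp (volume_on omega) (leey 1%E).
Definition Lp_boundary Omega p (p1 : (1 <= p)%E) : normedModType R :=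
  Lp (surface Omega) p1.

(* An element of L^oo(omega) as a function supported in omega. *)
Definition extend omega (xi : Linfty omega) (y : 'rV[R]_d) : R :=
  \1_omega y * Lp_fun xi y.

Definition K1_integral (alpha0 : R) Omega omega
    (G : 'rV[R]_d -> 'rV[R]_d -> R) (u0 : 'rV[R]_d -> R)
    (xi : Linfty omega) x : R :=
  alpha0 * \int[volume d]_(y in Omega) (G x y * extend xi y * u0 y).

Definition K2_integral (alpha0 : R) Omega omega
    (G : 'rV[R]_d -> 'rV[R]_d -> R) (u0 : 'rV[R]_d -> R)
    (xi1 xi2 : Linfty omega) x : R :=
  - alpha0 ^+ 2 * \int[volume d]_(y1 in Omega) \int[volume d]_(y2 in Omega)
    (G x y1 * extend xi1 y1 * G y1 y2 * extend xi2 y2 * u0 y2).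

End born_operators.

Section operators.
Context {R : realType}.
Implicit Types X Y : normedModType R.

Definition opnorm X Y (A : X -> Y) : \bar R :=
  ereal_sup [set `|A x|%:E | x in [set x | `|x| <= 1]].

Definition mopnorm X Y j (A : j.-tuple Y -> X) : \bar R :=
  ereal_sup [set `|A t|%:E | t in [set t | forall i, `|tnth t i| <= 1]].

Definition set_tnth (T : Type) j (t : j.-tuple T) (i : 'I_j) (u : T) : j.-tuple T :=
  [tuple if k == i then u else tnth t k | k < j].

Definition multilinear X Y j (A : j.-tuple Y -> X) :=
  forall t i (a : R) u v,
    A (set_tnth t i (a *: u + v)) = a *: A (set_tnth t i u) + A (set_tnth t i v).

Definition bounded_multilinear X Y j (A : j.-tuple Y -> X) :=
  multilinear A /\ (mopnorm A < +oo)%E.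

Definition tensor_power (T : Type) j (phi : T) : j.-tuple T := [tuple of nseq j phi].

(* The operators depend on a parameter i, and eps i is the corresponding value of
   epsilon: A i - B i is O(eps i) uniformly in i. Any family is allowed; one with
   values of eps accumulating at 0 gives the asymptotic statement eps -> 0. *)
Definition op_simeq (I : Type) (eps : I -> R) X Y j (A B : I -> j.-tuple Y -> X) :=
  exists C : R, forall i, (mopnorm (A i \- B i)%R <= (C * eps i)%:E)%E.

(* a i phi and b i phi, elements of X depending on phi and on the parameter, are
   obtained by applying multilinear operators to tensor powers of phi, and the
   operators of equal degree are equivalent. In particular, for each phi,
   `|a i phi - b i phi| <= C * eps i with C independent of i. *)
Definition elt_simeq (I : Type) (eps : I -> R) X Y (a b : I -> Y -> X) :=
  exists (n : nat) (A B : I -> forall j, j.-tuple Y -> X),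
  [/\ forall i j, bounded_multilinear (A i j) /\ bounded_multilinear (B i j),
      forall i phi, a i phi = \sum_(1 <= j < n.+1) A i j (tensor_power j phi),
      forall i phi, b i phi = \sum_(1 <= j < n.+1) B i j (tensor_power j phi) &
      forall j, op_simeq eps (fun i => A i j) (fun i => B i j)].

End operators.

Section reduced_inverse_born.
Context {R : realType} {X Y : normedModType R}.
Variables (K1 : X -> Y) (K2 : X -> X -> Y) (calK : Y -> X).

(* The paper's recursion for j >= 3, which for j = 2 reads
   - calK (K2 (calK phi_1) (calK phi_2)); the value at j = 0 is not used. *)
Fixpoint Ktilde (j : nat) : j.-tuple Y -> X :=
  match j with
  | 0%N => fun _ => 0
  | j'.+1 =>
    match j' as k return (k.-tuple Y -> X) -> k.+1.-tuple Y -> X with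
    | 0%N => fun _ phi => calK (thead phi)
    | k.+1 => fun Ktilde_prev phi =>
      let psi := map_tuple calK phi in
      - Ktilde_prev [tuple of K2 (thead psi) (thead [tuple of behead psi]) ::
                     map K1 (behead (behead psi))]
    end (@Ktilde j')
  end.

Fixpoint eta_iter (phi : Y) (n : nat) : X :=
  match n with
  | 0%N => 0
  | n'.+1 =>
    match n' with
    | 0%N => calK phi
    | m.+1 => eta_iter phi n' -
              calK (K2 (eta_iter phi n' - eta_iter phi m) (calK phi))
    end
  end.

Definition eta_term (phi : Y) (j : nat) : X := Ktilde (tensor_power j phi).

End reduced_inverse_born.

(* Main.v *)
Require Import Defs.
From HB Require Import structures.
From mathcomp Require Import all_boot all_order all_algebra.
From mathcomp Require Import sesquilinear interval_inference.
From mathcomp Require Import boolp classical_sets functions reals ereal topology.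
From mathcomp Require Import normedtype sequences derive measure.
From mathcomp Require Import lebesgue_measure lebesgue_integral hoelder.
From mathcomp Require Import ring.

Set Implicit Arguments.
Unset Strict Implicit.
Unset Printing Implicit Defensive.
Import Order.TTheory GRing.Theory Num.Theory.
Import numFieldNormedType.Exports.

Local Open Scope classical_set_scope.
Local Open Scope ring_scope.

(* The increments of the iteration satisfy
   a_{j+1} = - calK (K2 a_j a_1) with a_1 = calK phi, so that the n-th iterate is
   the sum of the left-nested products a_1, ..., a_n. This left-nested product is
   again a [Ktilde], taken over L^oo(omega) alone: [K1] and [calK] are replaced by
   the identity and [K2] by [calK \o K2], all the arguments being calK phi. It
   differs from the reduced Born term only in that the latter carries factors
   calK K1 = I + eps V in some of its slots, which costs O(eps) since these
   multilinear maps are Lipschitz on bounded sets, with constants depending only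
   on the norms of the operators. *)

(** * Tuples: entrywise properties and replacement of one entry *)

Lemma tnth_cons_ind (T : Type) n (x : T) (t : n.-tuple T)
    (P : 'I_n.+1 -> T -> Prop) :
  P ord0 x -> (forall k, P (lift ord0 k) (tnth t k)) ->
  forall k, P k (tnth [tuple of x :: t] k).
Proof.
by move=> Px Pt k; case: (unliftP ord0 k) => [k' ->|->]; rewrite ?tnthS ?tnth0.
Qed.

Lemma set_tnth_cons0 (T : Type) n (x u : T) (t : n.-tuple T) :
  set_tnth [tuple of x :: t] ord0 u = [tuple of u :: t].
Proof.
apply: eq_from_tnth => k; rewrite tnth_mktuple.
case: (unliftP ord0 k) => [k' ->|->]; last by rewrite eqxx tnth0.
by rewrite eq_sym (negPf (neq_lift _ _)) !tnthS.
Qed.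

Lemma set_tnth_consS (T : Type) n (x u : T) (t : n.-tuple T) i :
  set_tnth [tuple of x :: t] (lift ord0 i) u = [tuple of x :: set_tnth t i u].
Proof.
apply: eq_from_tnth => k; rewrite tnth_mktuple.
case: (unliftP ord0 k) => [k' ->|->]; last by rewrite (negPf (neq_lift _ _)) !tnth0.
by rewrite (inj_eq lift_inj) !tnthS tnth_mktuple.
Qed.

Lemma map_set_tnth (T U : Type) (g : T -> U) n (t : n.-tuple T) i u :
  map_tuple g (set_tnth t i u) = set_tnth (map_tuple g t) i (g u).
Proof.
by apply: eq_from_tnth => k; rewrite tnth_map !tnth_mktuple; case: eqP; rewrite ?tnth_map.
Qed.

Section bilinear_comp.
Context {R : realType} {X Y : normedModType R}.

(** Named so that it can carry the bilinear structure declared below; [calK \o K2] can then stand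
    for [K2] in the lemmas on [Ktilde]. *)
Definition bilinear_comp (T : Y -> X) (K2 : X -> X -> Y) x y : X := T (K2 x y).

Context (T : {linear Y -> X}) (K2 : {bilinear X -> X -> Y}).

Lemma bilinear_comp_bilinear :
  bilinear_for *:%R *:%R (bilinear_comp T K2 : X -> X -> X).
Proof.
by split=> z a x y; rewrite /bilinear_comp ?linearPl ?linearPr linearP.
Qed.
HB.instance Definition _ := bilinear_isBilinear.Build R X X X *:%R *:%R
  (bilinear_comp T K2) bilinear_comp_bilinear.

End bilinear_comp.

(** * Bounds for operator norms *)

Section operator_norms.
Context {R : realType} {X Y : normedModType R}.

(** Follows by scaling [x] to norm 1. A real bound [M] is used because [opnorm] is an extended
    real. *)
Lemma opnorm_ub (A : {linear X -> Y}) M :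
  (opnorm A <= M%:E)%E -> forall x, `|A x| <= M * `|x|.
Proof.
move=> AM x; have [->|x0] := eqVneq x 0; first by rewrite linear0 !normr0 mulr0.
have nx : 0 < `|x| by rewrite normr_gt0.
have : (`|A (`|x|^-1 *: x)|%:E <= M%:E)%E.
  apply: le_trans AM; apply: ereal_sup_ubound; exists (`|x|^-1 *: x) => //=.
  by rewrite normrZ gtr0_norm ?invr_gt0// mulVf ?gt_eqF.
by rewrite lee_fin linearZ normrZ gtr0_norm ?invr_gt0// ler_pdivrMl// mulrC.
Qed.

Lemma mopnorm_le n (A : n.-tuple Y -> X) M :
  (forall t, (forall k, `|tnth t k| <= 1) -> `|A t| <= M) -> (mopnorm A <= M%:E)%E.
Proof. by move=> AM; apply: ge_ereal_sup => _ [t /= t1 <-]; rewrite lee_fin AM. Qed.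

End operator_norms.

(** * Multilinearity, bounds and comparison for the recursive products *)

Section Ktilde_theory.
Context {R : realType}.
Implicit Types X Y : normedModType R.

(** The form of the recursion that suits induction: nested tuples replace [thead] and [behead], and
    one composed map replaces two. *)
Lemma Ktilde_cons2 X Y (K1 : X -> Y) (K2 : X -> X -> Y) (calK : Y -> X) n
    (x y : Y) (t : n.-tuple Y) :
  Ktilde K1 K2 calK [tuple of x :: [tuple of y :: t]] =
  - Ktilde K1 K2 calK [tuple of K2 (calK x) (calK y) :: map_tuple (K1 \o calK) t].
Proof.
rewrite [LHS]/=; congr (- _); congr (Ktilde _ _ _ _).
by apply: val_inj => /=; rewrite -map_comp; congr (K2 _ _ :: _).
Qed.

Lemma Ktilde1 X Y (K1 : X -> Y) (K2 : X -> X -> Y) (calK : Y -> X) x :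
  Ktilde K1 K2 calK [tuple x] = calK x.
Proof. by []. Qed.

(** Induction on the degree: slots 0 and 1 are the arguments of [K2] and feed slot 0 of the shorter
    product; slot [k + 2] feeds slot [k + 1] through the linear map [K1 \o calK]. *)
Lemma Ktilde_multilinear X Y (K1 : {linear X -> Y}) (K2 : {bilinear X -> X -> Y})
    (calK : {linear Y -> X}) j :
  multilinear (@Ktilde R X Y K1 K2 calK j).
Proof.
elim: j => [t []//|[_ t i a u v|j IH t]].
  case: t / tupleP => x t; rewrite (ord1 i) !set_tnth_cons0.
  by rewrite (tuple0 t) !Ktilde1 linearP.
have IH0 (s : j.-tuple Y) a u v : Ktilde K1 K2 calK [tuple of (a *: u + v) :: s] =
    a *: Ktilde K1 K2 calK [tuple of u :: s] + Ktilde K1 K2 calK [tuple of v :: s].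
  by have := IH [tuple of 0 :: s] ord0 a u v; rewrite !set_tnth_cons0.
case: t / tupleP => x t; case: t / tupleP => y t i a u v.
case: (unliftP ord0 i) => [i' ->|->]; last first.
  by rewrite !set_tnth_cons0 !Ktilde_cons2 linearP linearPl IH0 opprD scalerN.
case: (unliftP ord0 i') => [k ->|->]; last first.
  rewrite !set_tnth_consS !set_tnth_cons0 !Ktilde_cons2 linearP linearPr.
  by rewrite IH0 opprD scalerN.
rewrite !set_tnth_consS !Ktilde_cons2 !map_set_tnth (linearP (K1 \o calK)).
by rewrite -!set_tnth_consS IH opprD scalerN.
Qed.

(** [C] is chosen before the operators, hence is uniform over any family with the bounds [a], [b],
    [c]. The radius [r] varies in the induction, since unfolding changes the size of the
    arguments. *)
Lemma Ktilde_bounded X Y (a b c r : R) j : 0 <= a -> 0 <= b -> 0 <= c -> 0 <= r ->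
  exists C : R, forall (K1 : X -> Y) (K2 : X -> X -> Y) (calK : Y -> X),
    (forall x, `|K1 x| <= a * `|x|) ->
    (forall x y, `|K2 x y| <= b * `|x| * `|y|) ->
    (forall x, `|calK x| <= c * `|x|) ->
    forall t : j.-tuple Y, (forall k, `|tnth t k| <= r) ->
      `|Ktilde K1 K2 calK t| <= C.
Proof.
move=> a0 b0 c0; elim: j r => [|[_|j IH]] r r0.
- by exists 0 => *; rewrite normr0.
- exists (c * r) => K1 K2 calK _ _ cK t.
  case: t / tupleP => x t tr; rewrite (tuple0 t) Ktilde1.
  apply: le_trans (cK x) _; apply: ler_wpM2l => //.
  by have := tr ord0; rewrite tnth0.
(* The first summand bounds the new head, the second the entries [K1 (calK z)]; the sum serves both
   in place of a maximum. *)
set r' := b * (c * r) * (c * r) + a * (c * r).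
have p1 : 0 <= b * (c * r) * (c * r) by rewrite !mulr_ge0.
have p2 : 0 <= a * (c * r) by rewrite !mulr_ge0.
have [|C HC] := IH r'; first exact: addr_ge0.
exists C => K1 K2 calK aK1 bK2 cK t.
case: t / tupleP => x t; case: t / tupleP => y t tr.
have crK z : `|z| <= r -> `|calK z| <= c * r.
  by move=> zr; apply: le_trans (cK z) _; exact: ler_wpM2l.
have xr : `|x| <= r by have := tr ord0; rewrite tnth0.
have yr : `|y| <= r by have := tr (lift ord0 ord0); rewrite tnthS tnth0.
rewrite Ktilde_cons2 normrN; apply: (HC K1 K2 calK) => //.
apply: (@tnth_cons_ind _ _ _ _ (fun _ z => `|z| <= r')).
  apply: le_trans (bK2 _ _) _; rewrite -[leLHS]addr0; apply: lerD => //.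
  by rewrite ler_pM ?mulr_ge0 ?crK// ler_wpM2l ?crK.
move=> k; rewrite tnth_map /=; apply: le_trans (aK1 _) _.
rewrite -[leLHS]add0r; apply: lerD => //; apply: ler_wpM2l => //; apply: crK.
by have := tr (lift ord0 (lift ord0 k)); rewrite !tnthS.
Qed.

(** One unfolding turns entrywise distance [e] into at most [L * e] and radius [r] into [r'], so the
    constant of the shorter product gets multiplied by [L]. *)
Lemma Ktilde_lipschitz X Y (a b c r : R) j :
  0 <= a -> 0 <= b -> 0 <= c -> 0 <= r ->
  exists C : R, forall (K1 : {linear X -> Y}) (K2 : {bilinear X -> X -> Y})
      (calK : {linear Y -> X}),
    (forall x, `|K1 x| <= a * `|x|) ->
    (forall x y, `|K2 x y| <= b * `|x| * `|y|) ->
    (forall x, `|calK x| <= c * `|x|) ->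
    forall (e : R) (s t : j.-tuple Y), 0 <= e ->
      (forall k, `|tnth s k| <= r) -> (forall k, `|tnth t k| <= r) ->
      (forall k, `|tnth s k - tnth t k| <= e) ->
      `|Ktilde K1 K2 calK s - Ktilde K1 K2 calK t| <= C * e.
Proof.
move=> a0 b0 c0; elim: j r => [|[_|j IH]] r r0.
- by exists 0 => *; rewrite subrr normr0 mul0r.
- exists c => K1 K2 calK _ _ cK e s t e0 _ _.
  case: s / tupleP => x s; case: t / tupleP => y t st.
  rewrite (tuple0 s) (tuple0 t) !Ktilde1 -linearB.
  apply: le_trans (cK _) _; apply: ler_wpM2l => //.
  by have := st ord0; rewrite !tnth0.
set r' := b * (c * r) * (c * r) + a * (c * r).
have p1 : 0 <= b * (c * r) * (c * r) by rewrite !mulr_ge0.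
have p2 : 0 <= a * (c * r) by rewrite !mulr_ge0.
have [|C HC] := IH r'; first exact: addr_ge0.
(* The first two summands come from changing one argument of [K2] at a time, the third from
   [K1 \o calK]. *)
set L := b * c * (c * r) + b * (c * r) * c + a * c.
exists (C * L) => K1 K2 calK aK1 bK2 cK e s t e0.
case: s / tupleP => x s; case: s / tupleP => y s.
case: t / tupleP => x' t; case: t / tupleP => y' t sr tr ste.
have crK z : `|z| <= r -> `|calK z| <= c * r.
  by move=> zr; apply: le_trans (cK z) _; exact: ler_wpM2l.
have ceK z z' : `|z - z'| <= e -> `|calK z - calK z'| <= c * e.
  by move=> ze; rewrite -linearB; apply: le_trans (cK _) _; exact: ler_wpM2l.
have xr : `|x| <= r by have := sr ord0; rewrite tnth0.
have yr : `|y| <= r by have := sr (lift ord0 ord0); rewrite tnthS tnth0.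
have xr' : `|x'| <= r by have := tr ord0; rewrite tnth0.
have yr' : `|y'| <= r by have := tr (lift ord0 ord0); rewrite tnthS tnth0.
have xe : `|x - x'| <= e by have := ste ord0; rewrite !tnth0.
have ye : `|y - y'| <= e by have := ste (lift ord0 ord0); rewrite !tnthS !tnth0.
have inr z w (u : j.-tuple Y) : `|z| <= r -> `|w| <= r ->
    (forall k, `|tnth u k| <= r) ->
    forall k, `|tnth [tuple of K2 (calK z) (calK w) :: map_tuple (K1 \o calK) u] k| <= r'.
  move=> zr wr ur; apply: (@tnth_cons_ind _ _ _ _ (fun _ z => `|z| <= r')).
    apply: le_trans (bK2 _ _) _; rewrite -[leLHS]addr0; apply: lerD => //.
    by rewrite ler_pM ?mulr_ge0 ?crK// ler_wpM2l ?crK.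
  move=> k; rewrite tnth_map /=; apply: le_trans (aK1 _) _.
  rewrite -[leLHS]add0r; apply: lerD => //; apply: ler_wpM2l => //; exact: crK.
rewrite !Ktilde_cons2 -opprD normrN -mulrA.
apply: (HC K1 K2 calK) => //.
- by rewrite mulr_ge0// !addr_ge0// ?mulr_ge0.
- apply: inr => // k.
  by have := sr (lift ord0 (lift ord0 k)); rewrite !tnthS.
- apply: inr => // k.
  by have := tr (lift ord0 (lift ord0 k)); rewrite !tnthS.
set S := [tuple of K2 (calK x') _ :: _].
apply: (@tnth_cons_ind _ _ _ _ (fun k z => `|z - tnth S k| <= L * e)).
  rewrite /S tnth0.
  have -> : K2 (calK x) (calK y) - K2 (calK x') (calK y') =
      K2 (calK x - calK x') (calK y) + K2 (calK x') (calK y - calK y').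
    by rewrite linearBl linearBr addrA subrK.
  apply: le_trans (ler_normD _ _) _; rewrite mulrDl -[leLHS]addr0; apply: lerD.
    rewrite mulrDl; apply: lerD; (apply: le_trans (bK2 _ _) _).
      rewrite [leRHS](_ : _ = b * (c * e) * (c * r)); last by ring.
      by apply: ler_pM; rewrite ?mulr_ge0 ?crK//; apply: ler_wpM2l; rewrite ?ceK.
    rewrite [leRHS](_ : _ = b * (c * r) * (c * e)); last by ring.
    by apply: ler_pM; rewrite ?mulr_ge0 ?ceK//; apply: ler_wpM2l; rewrite ?crK.
  by rewrite !mulr_ge0.
move=> k; rewrite /S tnthS !tnth_map -(linearB (K1 \o calK)) /=.
apply: le_trans (aK1 _) _.
rewrite mulrDl -[leLHS]add0r; apply: lerD; first by rewrite mulr_ge0// addr_ge0// !mulr_ge0.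
rewrite -mulrA; apply: ler_wpM2l => //; rewrite linearB; apply: ceK.
by have := ste (lift ord0 (lift ord0 k)); rewrite !tnthS.
Qed.

(* If [calK \o K1] were the identity, the two sides of the difference would be
   equal. *)
Lemma Ktilde_approx X Y (a b c r : R) j :
  0 <= a -> 0 <= b -> 0 <= c -> 0 <= r ->
  exists C : R, forall (K1 : {linear X -> Y}) (K2 : {bilinear X -> X -> Y})
      (calK : {linear Y -> X}) (e : R),
    (forall x, `|K1 x| <= a * `|x|) ->
    (forall x y, `|K2 x y| <= b * `|x| * `|y|) ->
    (forall x, `|calK x| <= c * `|x|) ->
    0 <= e -> (forall x, `|calK (K1 x) - x| <= e * `|x|) ->
    forall t : j.-tuple Y, (forall k, `|tnth t k| <= r) ->
      `|Ktilde K1 K2 calK t -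
        Ktilde idfun (bilinear_comp calK K2) idfun (map_tuple calK t)| <= C * e.
Proof.
move=> a0 b0 c0; elim: j r => [|[_|j IH]] r r0.
- by exists 0 => *; rewrite subrr normr0 mul0r.
(* In degree 1 no factor [calK \o K1] occurs and the two sides agree. *)
- exists 0 => K1 K2 calK e _ _ _ _ _ t _; case: t / tupleP => x t.
  by rewrite (tuple0 t) Ktilde1 [X in _ - X]/= subrr normr0 mul0r.
set r' := b * (c * r) * (c * r) + a * (c * r).
have p1 : 0 <= b * (c * r) * (c * r) by rewrite !mulr_ge0.
have p2 : 0 <= a * (c * r) by rewrite !mulr_ge0.
have [|C HC] := IH r'; first exact: addr_ge0.
have r'0 : 0 <= r' by rewrite addr_ge0.
(* A common radius for [map_tuple calK s] and [u] below: [c * r'] covers the former and the head of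
   [u], [c * r] the tail of [u]. *)
set rho := c * r' + c * r.
have [||||C' HC'] := @Ktilde_lipschitz X X 1 (c * b) 1 rho j.+1 => //.
- exact: mulr_ge0.
- by rewrite addr_ge0// mulr_ge0.
(* [C] is the induction hypothesis at [s]; [C'] is the Lipschitz constant, applied to tuples at
   entrywise distance at most [e * (c * r)]. *)
exists (C + C' * (c * r)) => K1 K2 calK e aK1 bK2 cK e0 eK t.
case: t / tupleP => x t; case: t / tupleP => y t tr.
have crK z : `|z| <= r -> `|calK z| <= c * r.
  by move=> zr; apply: le_trans (cK z) _; exact: ler_wpM2l.
have xr : `|x| <= r by have := tr ord0; rewrite tnth0.
have yr : `|y| <= r by have := tr (lift ord0 ord0); rewrite tnthS tnth0.
have tr2 k : `|tnth t k| <= r.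
  by have := tr (lift ord0 (lift ord0 k)); rewrite !tnthS.
have K2r : `|K2 (calK x) (calK y)| <= r'.
  apply: le_trans (bK2 _ _) _; rewrite -[leLHS]addr0; apply: lerD => //.
  by rewrite ler_pM ?mulr_ge0 ?crK// ler_wpM2l ?crK.
have K1r z : `|z| <= r -> `|K1 (calK z)| <= r'.
  move=> zr; apply: le_trans (aK1 _) _.
  by rewrite -[leLHS]add0r; apply: lerD => //; apply: ler_wpM2l => //; exact: crK.
set s := [tuple of K2 (calK x) (calK y) :: map_tuple (K1 \o calK) t].
set u := [tuple of calK (K2 (calK x) (calK y)) :: map_tuple calK t].
have -> : Ktilde idfun (bilinear_comp calK K2) idfun
    (map_tuple calK [tuple of x :: [tuple of y :: t]]) =
    - Ktilde idfun (bilinear_comp calK K2) idfun u.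
  transitivity (Ktilde idfun (bilinear_comp calK K2) idfun
      [tuple of calK x :: [tuple of calK y :: map_tuple calK t]]).
    by congr Ktilde; exact: val_inj.
  rewrite Ktilde_cons2; congr (- Ktilde _ _ _ _).
  by apply: val_inj => /=; rewrite map_id.
rewrite Ktilde_cons2 -/s -opprD normrN.
(* The intermediate value: its arguments have the same head as [u], and in the tail [calK (K1 z)]
   where [u] has [z]. *)
set w := Ktilde idfun (bilinear_comp calK K2) idfun (map_tuple calK s).
rewrite -(subrKA w) mulrDl; apply: le_trans (ler_normD _ _) _.
apply: lerD.
  apply: (HC K1 K2 calK e) => //.
  apply: (@tnth_cons_ind _ _ _ _ (fun _ z => `|z| <= r')) => // k.
  by rewrite tnth_map; exact: K1r.
rewrite -mulrA; apply: (HC' idfun (bilinear_comp calK K2) idfun).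
- by move=> z; rewrite mul1r.
- move=> z z'; rewrite /bilinear_comp; apply: le_trans (cK _) _.
  by rewrite -!mulrA; apply: ler_wpM2l => //; rewrite mulrA.
- by move=> z; rewrite mul1r.
- by rewrite !mulr_ge0.
- move=> k; rewrite tnth_map; apply: le_trans (cK _) _.
  rewrite -[leLHS]addr0; apply: lerD; last exact: mulr_ge0.
  apply: ler_wpM2l => //; move: k.
  apply: (@tnth_cons_ind _ _ _ _ (fun _ z => `|z| <= r')) => // k.
  by rewrite tnth_map; exact: K1r.
- apply: (@tnth_cons_ind _ _ _ _ (fun _ z => `|z| <= rho)).
    apply: le_trans (cK _) _; rewrite -[leLHS]addr0.
    by apply: lerD; rewrite ?mulr_ge0//; exact: ler_wpM2l.
  move=> k; rewrite tnth_map -[leLHS]add0r.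
  by apply: lerD; rewrite ?mulr_ge0// crK.
- move=> k; rewrite tnth_map; case: (unliftP ord0 k) => [k' ->|->].
    rewrite !tnthS !tnth_map /=; apply: le_trans (eK _) _.
    by rewrite [leRHS]mulrC ler_wpM2l// crK.
  by rewrite !tnth0 subrr normr0 !mulr_ge0.
Qed.

(** With identities for [K1] and [calK] the tail entries stay [z], so each unfolding only replaces
    the head [x] by [B x z], up to a sign. *)
Lemma Ktilde_id_iter X (B : {bilinear X -> X -> X}) n (x z : X) :
  Ktilde idfun B idfun [tuple of x :: nseq_tuple n z] = iter n (fun y => - B y z) x.
Proof.
elim: n x => [|n IH] x; first by [].
transitivity (Ktilde idfun B idfun [tuple of x :: [tuple of z :: nseq_tuple n z]]).
  by congr Ktilde; exact: val_inj.
rewrite Ktilde_cons2 iterSr /=.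
transitivity (- Ktilde idfun B idfun [tuple of B x z :: nseq_tuple n z]).
  by congr (- Ktilde _ _ _ _); apply: val_inj => /=; rewrite map_id.
(* What remains is that the iterated map, being linear, commutes with the sign. *)
rewrite IH; elim: n {IH} => //= n <-.
by rewrite linearNl.
Qed.

Lemma eta_iter_increment X Y (K2 : {bilinear X -> X -> Y}) (calK : {linear Y -> X})
    phi n :
  eta_iter K2 calK phi n.+1 - eta_iter K2 calK phi n =
  iter n (fun y => - calK (K2 y (calK phi))) (calK phi).
Proof.
elim: n => [|n IH]; first by rewrite /= subr0.
by rewrite [eta_iter _ _ _ n.+2]/= addrAC subrr add0r iterS -IH.
Qed.

(** Telescoping of the increments, with no error term. It presents the iterate as a sum of operators
    on tensor powers of [phi], as [elt_simeq] asks. *)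
Lemma eta_iter_sum X Y (K2 : {bilinear X -> X -> Y}) (calK : {linear Y -> X}) phi n :
  eta_iter K2 calK phi n = \sum_(1 <= j < n.+1)
    Ktilde idfun (bilinear_comp calK K2) idfun (map_tuple calK (tensor_power j phi)).
Proof.
elim: n => [|n IH]; first by rewrite big_geq.
rewrite big_nat_recr //= -IH -[LHS](subrK (eta_iter K2 calK phi n)).
rewrite eta_iter_increment addrC; congr (_ + _).
rewrite -(Ktilde_id_iter (bilinear_comp calK K2)).
by congr Ktilde; apply: val_inj; rewrite /= map_nseq.
Qed.

End Ktilde_theory.

(** * Equivalence of the iterates with the reduced inverse Born sums *)

Theorem theorem6p6 (R : realType) (d : nat) (d_ge2 : (2 <= d)%N)
  (Omega omega : set 'rV[R]_d)
  (Omega_domain : bounded_domain Omega)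
  (omega_closed : closed omega) (omega_sub : omega `<=` Omega)
  (omega_dist : exists2 r : R, 0 < r &
    forall x y, boundary omega x -> boundary Omega y -> r <= enorm (x - y))
  (D0 alpha0 beta : R)
  (D0_gt0 : 0 < D0) (alpha0_gt0 : 0 < alpha0) (beta_gt0 : 0 < beta)
  (f : ('rV[R]_d -> R) -> R) (u0 : 'rV[R]_d -> R)
  (u0_sol : exists S, [/\ compact S, S `<=` Omega &
    robin_solution D0 alpha0 beta Omega S f u0])
  (G : 'rV[R]_d -> 'rV[R]_d -> R)
  (G_green : robin_green D0 alpha0 beta Omega G)
  (p : \bar R) (p_ge1 : (1 <= p)%E)
  (K1 : {linear Linfty omega -> Lp_boundary Omega p_ge1})
  (K1_bounded : (opnorm K1 < +oo)%E)
  (K1_def : forall xi, {ae surface Omega, forall x,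
    Lp_fun (K1 xi) x = K1_integral alpha0 Omega G u0 xi x})
  (K2 : {bilinear Linfty omega -> Linfty omega -> Lp_boundary Omega p_ge1})
  (K2_bounded : exists C : R, forall xi1 xi2, `|K2 xi1 xi2| <= C * `|xi1| * `|xi2|)
  (K2_def : forall xi1 xi2, {ae surface Omega, forall x,
    Lp_fun (K2 xi1 xi2) x = K2_integral alpha0 Omega G u0 xi1 xi2 x})
  (I : Type) (eps : I -> R) (eps_gt0 : forall i, 0 < eps i)
  (calK : I -> {linear Lp_boundary Omega p_ge1 -> Linfty omega})
  (calK_bounded : exists M : R, forall i, (opnorm (calK i) <= M%:E)%E)
  (V : I -> {linear Linfty omega -> Linfty omega})
  (V_norm : forall i, opnorm (V i) = 1%E)
  (calK_K1 : forall i xi, calK i (K1 xi) = xi + eps i *: V i xi)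
  (n : nat) (n_ge1 : (1 <= n)%N) :
  elt_simeq eps
    (fun i phi => eta_iter K2 (calK i) phi n)
    (fun i phi => \sum_(1 <= j < n.+1) eta_term K1 K2 (calK i) phi j).
Proof.
pose B i := bilinear_comp (calK i) K2.
have [a0 K1a] : exists a0, (opnorm K1 <= a0%:E)%E.
  by move: K1_bounded; case: (opnorm K1) => [r _||_]//; [exists r|exists 0; rewrite leNye].
have [b0 K2b] := K2_bounded; have [c0 calKc] := calK_bounded.
(* Absolute values, since the given bounds come without a sign and the lemmas ask for nonnegative
   ones. *)
pose a := `|a0|; pose b := `|b0|; pose c := `|c0|.
have a_ge0 : 0 <= a := normr_ge0 a0.
have b_ge0 : 0 <= b := normr_ge0 b0.
have c_ge0 : 0 <= c := normr_ge0 c0.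
have aK1 x : `|K1 x| <= a * `|x|.
  apply: le_trans (opnorm_ub K1a x) _.
  by rewrite ler_wpM2r// ler_norm.
have bK2 x y : `|K2 x y| <= b * `|x| * `|y|.
  apply: le_trans (K2b x y) _.
  by do 2 rewrite ler_wpM2r//; rewrite ler_norm.
have cK i x : `|calK i x| <= c * `|x|.
  apply: le_trans (opnorm_ub (calKc i) x) _.
  by rewrite ler_wpM2r// ler_norm.
have eK i x : `|calK i (K1 x) - x| <= eps i * `|x|.
  rewrite calK_K1 addrAC subrr add0r normrZ gtr0_norm//.
  apply: ler_wpM2l; first exact: ltW.
  rewrite -[leRHS]mul1r.
  by apply: (@opnorm_ub _ _ _ (V i)); rewrite V_norm.
(* For the iterate, the degree-[j] operator is the product over [Linfty omega] precomposed with
   [calK i]; for the series it is [Ktilde] itself. *)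
exists n; exists (fun i j (t : j.-tuple _) => Ktilde idfun (B i) idfun (map_tuple (calK i) t)).
exists (fun i j (t : j.-tuple _) => Ktilde K1 K2 (calK i) t); split.
- move=> i j; split; split.
  + move=> t k s u v; rewrite !map_set_tnth linearP.
    exact: (Ktilde_multilinear idfun (B i) idfun).
  (* The radius is [c] because [calK i] sends entries of norm at most 1 to entries of norm at most
     [c]. *)
  + have [C HC] := @Ktilde_bounded R (Linfty omega) (Linfty omega) 1 (c * b) 1 c j
      ler01 (mulr_ge0 c_ge0 b_ge0) ler01 c_ge0.
    apply: (@le_lt_trans _ _ C%:E); last exact: ltry.
    apply: mopnorm_le => t t1; apply: (HC idfun (B i) idfun).
    * by move=> x; rewrite mul1r.
    * move=> x y; rewrite /B /bilinear_comp; apply: le_trans (cK _ _) _.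
      by rewrite -!mulrA; apply: ler_wpM2l => //; rewrite mulrA.
    * by move=> x; rewrite mul1r.
    * move=> k; rewrite tnth_map; apply: le_trans (cK _ _) _.
      by rewrite -[leRHS]mulr1 ler_wpM2l.
  + exact: Ktilde_multilinear.
  + have [C HC] := @Ktilde_bounded R (Linfty omega) (Lp_boundary Omega p_ge1)
      a b c 1 j a_ge0 b_ge0 c_ge0 ler01.
    apply: (@le_lt_trans _ _ C%:E); last exact: ltry.
    by apply: mopnorm_le => t t1; apply: HC.
- by move=> i phi; exact: eta_iter_sum.
- by [].
(* [C] does not depend on [i], because [a], [b] and [c] do not. *)
- move=> j.
  have [C HC] := @Ktilde_approx R (Linfty omega) (Lp_boundary Omega p_ge1)
      a b c 1 j a_ge0 b_ge0 c_ge0 ler01.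
  exists C => i; apply: mopnorm_le => t t1.
  by rewrite /= distrC; apply: HC => //; exact: ltW.
Qed.
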